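(* Let $f\in C^1(\mathbb R)$ and $u_0,u_1\in\mathbb R$. For $\nu\ge1$ let $\hat u^\nu$ be the unique solution of $$\nu\hat u^\nu_{xx}=(f(\hat u^\nu))_x\ \ (0<x<1),\qquad \hat u^\nu(0)=u_0,\quad\hat u^\nu(1)=u_1 .$$ There exists a constant $C>0$ depending only on $f$, $u_0$ and $u_1$ such that for any $\nu\ge 1$ and any $x\in[0,1]$ $$\big|\hat u^\nu(x)-\big((u_1-u_0)x+u_0\big)\big|\le\frac{C}{\nu}.$$
   Context: For every $\nu>0$ the boundary value problem in the claim has a unique (classical) solution. *)

(* Defs.v *)
From HB Require Import structures.
From mathcomp Require Import all_boot all_order all_algebra.
From mathcomp Require Import all_classical all_reals all_analysis.

Set Implicit Arguments.
Unset Strict Implicit.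
Unset Printing Implicit Defensive.

Import Order.TTheory GRing.Theory Num.Theory.
Import numFieldNormedType.Exports.

#[global] Open Scope ring_scope.
#[global] Open Scope classical_set_scope.

Definition C1 (R : realType) (f : R -> R) : Prop :=
  (forall x : R, derivable f x 1) /\ continuous f^`().

(* Classical regularity, C^2(]0,1[) and C^0([0,1]).  The function u is total,
   but only its values on [0,1] matter: the derivatives are taken at interior
   points, and at 0 and 1 only one-sided continuity is required. *)
Record classical_reg (R : realType) (u : R -> R) : Prop := ClassicalReg {
  reg_continuous : {within `[0 : R, 1], continuous u};
  reg_derivable1 : forall x : R, 0 < x < 1 -> derivable u x 1;
  reg_derivable2 : forall x : R, 0 < x < 1 -> derivable u^`() x 1;
  reg_continuous2 : forall x : R, 0 < x < 1 -> {for x, continuous u^`(2)} }.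

Record bvp_solution (R : realType) (f : R -> R) (u0 u1 nu : R) (u : R -> R)
    : Prop := BvpSolution {
  bvp_reg : classical_reg u;
  bvp_eq : forall x : R, 0 < x < 1 -> nu * u^`(2)%classic x = (f \o u)^`() x;
  bvp_left : u 0 = u0;
  bvp_right : u 1 = u1 }.

(* Main.v *)
(* Integrating once, nu u' - f(u) is constant on ]0,1[.  If u' vanishes at an
   interior point c, then nu u' = f(u) - f(u c) with f locally Lipschitz, so u is
   constant; hence an interior extremum is also a boundary value and u takes its
   values between u0 and u1, uniformly in nu.  If K bounds |f| there, then
   w = u - (affine interpolant) satisfies nu w' = f(u) - f(u z) at some fixed z by
   Rolle's theorem, so |w'| <= 2K/nu, and w(0) = 0 concludes. *)
Require Import Defs.
From HB Require Import structures.
From mathcomp Require Import all_boot all_order all_algebra.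
From mathcomp Require Import ring lra.
From mathcomp Require Import all_classical all_reals all_analysis.
Import Order.TTheory GRing.Theory Num.Theory.
Import numFieldNormedType.Exports.

Set Implicit Arguments.
Unset Strict Implicit.
Unset Printing Implicit Defensive.

Lemma within_continuous_norm_bounded (R : realType) (f : R -> R) (a b : R) :
  {within `[a, b], continuous f} ->
  exists2 M, 0 <= M & forall x, x \in `[a, b]%R -> `|f x| <= M.
Proof.
move=> cf; have [ab|ba] := leP a b; last first.
  exists 0 => // x; rewrite in_itv/= => /andP[ax xb].
  by move: (le_trans ax xb); rewrite leNgt ba.
have cnf : {within `[a, b], continuous (fun x => `|f x|)}.
  by move=> x; apply: cvg_norm; exact: cf.
have [c _ cmax] := EVT_max ab cnf.
by exists `|f c|.
Qed.

Lemma is_derive_derive1 (R : realType) (f : R -> R) (x : R) :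
  derivable f x 1 -> is_derive x 1 f (f^`()%classic x).
Proof. by move=> df; rewrite derive1E; exact: derivableP. Qed.

Lemma derivable_continuousT (R : realType) (f : R -> R) :
  (forall x, derivable f x 1) -> continuous f.
Proof. by move=> df x; apply: differentiable_continuous; exact/derivable1_diffP. Qed.

(** By the mean value theorem, with [L] a bound of the continuous derivative on the compact
    interval. This is the local Lipschitz property that feeds the Gronwall argument. *)
Lemma C1_lipschitz_itv (R : realType) (f : R -> R) (a b : R) : C1 f ->
  exists2 L, 0 <= L & forall x y, x \in `[a, b]%R -> y \in `[a, b]%R ->
    `|f x - f y| <= L * `|x - y|.
Proof.
move=> [df cdf].
have [L L0 bL] := @within_continuous_norm_bounded _ f^`()%classic a b
  (continuous_subspaceT cdf).
exists L => //.
have main x y : x \in `[a, b]%R -> y \in `[a, b]%R -> y <= x ->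
    `|f x - f y| <= L * `|x - y|.
  rewrite !in_itv/= => /andP[ax xb] /andP[ay yb] yx.
  have [c + ->] := MVT_segment yx (fun z _ => is_derive_derive1 (df z))
    (continuous_subspaceT (derivable_continuousT df)).
  rewrite in_itv/= => /andP[yc cx]; rewrite normrM ler_wpM2r// bL// in_itv/=.
  by rewrite (le_trans ay yc) (le_trans cx xb).
move=> x y xab yab; have [yx|/ltW xy] := leP y x; first exact: main.
by rewrite distrC [`|x - y|]distrC; exact: main.
Qed.

(* Gronwall in both directions: w^2 e^(2Kx) is nondecreasing, w^2 e^(-2Kx) is
   nonincreasing, and both vanish at c. *)
Lemma eq0_of_norm_derive_le (R : realType) (w : R -> R) (a b c K : R) :
  {within `[a, b], continuous w} ->
  (forall x, x \in `]a, b[%R -> derivable w x 1) ->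
  (forall x, x \in `]a, b[%R -> `|w^`()%classic x| <= K * `|w x|) ->
  c \in `[a, b]%R -> w c = 0 -> forall x, x \in `[a, b]%R -> w x = 0.
Proof.
move=> cw dw wK cab wc0 x xab.
pose g (s y : R) := w y * w y * expR (s * y).
have dg s y : y \in `]a, b[%R ->
    is_derive y 1 (g s) (expR (s * y) * (2 * (w y * w^`()%classic y) + s * (w y) ^+ 2)).
  move=> yab; have dwy := is_derive_derive1 (dw _ yab).
  have des : is_derive y 1 (fun y => expR (s * y)) (s * expR (s * y)).
    have dm : is_derive y 1 (fun y => s * y) s.
      by apply: is_derive_eq; rewrite /GRing.scale/=; ring.
    by have := @is_derive1_comp _ expR (fun y => s * y) y _ _ (is_derive_expR _) dm; rewrite mulrC.
  have := is_deriveM (is_deriveM dwy dwy) des.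
  have E (W D e : R) :
    W * W * (s * e) + e * (W * D + W * D) = e * (2 * (W * D) + s * W ^+ 2) by ring.
  by move/is_derive_eq; apply; exact: E.
have cg s : {within `[a, b], continuous (g s)}.
  move=> y; apply: cvgM; first by apply: cvgM; exact: cw.
  by apply: (continuous_subspaceT (f := fun y => expR (s * y))) => z;
     apply: continuous_comp; [apply: cvgMl_tmp; exact: cvg_id|exact: continuous_expR].
(* The derivative of [g s] has the sign of [2 w w' + s w^2]; this bound on [w w'] makes it
   nonnegative for [s = 2K] and nonpositive for [s = - 2K]. *)
have key y : y \in `]a, b[%R -> `|w y * w^`()%classic y| <= K * (w y) ^+ 2.
  move=> yab; rewrite normrM -real_normK ?num_real// expr2 mulrCA.
  by rewrite ler_wpM2l// wK.
(* Since [g s c = 0] and the exponential is positive, the comparison forces the square of [w x] to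
   be at most 0. The side of [c] on which [x] lies then decides the sign of [s]. *)
have w0 s : g s x <= g s c -> w x = 0.
  rewrite {2}/g wc0 mulr0 mul0r /g pmulr_lle0 ?expR_gt0// -expr2 => h.
  by apply/eqP; rewrite -sqrf_eq0 eq_le h sqr_ge0.
have [xc|/ltW cx] := leP x c.
- apply: (w0 (2 * K)); apply: (@ger0_derive1_le_cc _ _ a b) => // y yab.
    by case: (dg (2 * K) y yab).
  rewrite derive1E (@derive_val _ _ _ _ _ _ _ (dg (2 * K) y yab)).
  rewrite mulr_ge0 ?expR_ge0//.
  by have := key y yab; rewrite ler_norml => /andP[]; lra.
- apply: (w0 (- (2 * K))); apply: (@ler0_derive1_le_cc _ _ a b) => // y yab.
    by case: (dg (- (2 * K)) y yab).
  rewrite derive1E (@derive_val _ _ _ _ _ _ _ (dg (- (2 * K)) y yab)).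
  rewrite mulr_ge0_le0 ?expR_ge0//.
  by have := key y yab; rewrite ler_norml => /andP[]; lra.
Qed.

(** The mean value theorem is applied on the closed segment between the two points, so nothing is
    asked of [F] at [a] and [b]. This suits a first integral containing [u'], which is controlled
    only in the interior. *)
Lemma derive1_eq0_cst_oo (R : realType) (F : R -> R) (a b : R) :
  (forall x, x \in `]a, b[%R -> is_derive x 1 F 0) ->
  forall x y, x \in `]a, b[%R -> y \in `]a, b[%R -> F x = F y.
Proof.
move=> dF.
have main x y : x \in `]a, b[%R -> y \in `]a, b[%R -> x <= y -> F x = F y.
  rewrite !in_itv/= => /andP[ax xb] /andP[ay yb] xy.
  have sub z : z \in `[x, y]%R -> z \in `]a, b[%R.
    by rewrite !in_itv/= => /andP[xz zy]; rewrite (lt_le_trans ax xz) (le_lt_trans zy yb).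
  have dF' z : z \in `]x, y[%R -> is_derive z 1 F 0.
    by move=> zxy; apply/dF/sub; exact: subset_itv_oo_cc.
  have [z _] := MVT_segment (df := fun=> 0) xy dF'
    (derivable_within_continuous (fun z zxy => @ex_derive _ _ _ _ _ _ _ (dF z (sub z zxy)))).
  by rewrite mul0r => /eqP; rewrite subr_eq0 => /eqP.
move=> x y xab yab; have [xy|/ltW yx] := leP x y; first exact: main.
by apply/esym; exact: main.
Qed.

Section bvp.
Context (R : realType) (f : R -> R) (u0 u1 nu : R) (u : R -> R).
Hypotheses (hf : C1 f) (nu0 : 0 < nu) (hu : bvp_solution f u0 u1 nu u).

Let cu : {within `[0 : R, 1], continuous u}.
Proof. by case: hu => -[]. Qed.

Let du (x : R) : x \in `]0, 1[%R -> derivable u x 1.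
Proof. by rewrite in_itv/=; exact: (reg_derivable1 (bvp_reg hu)). Qed.

Lemma bvp_first_integral (x y : R) : x \in `]0, 1[%R -> y \in `]0, 1[%R ->
  nu * u^`()%classic x - f (u x) = nu * u^`()%classic y - f (u y).
Proof.
apply: (@derive1_eq0_cst_oo _ (fun x => nu * u^`()%classic x - f (u x))) => z z01.
have dfu : is_derive z 1 (f \o u) ((f \o u)^`()%classic z).
  apply: is_derive_derive1; apply/derivable1_diffP/differentiable_comp.
    exact/derivable1_diffP/du.
  exact/derivable1_diffP/(hf.1).
have ddu : is_derive z 1 u^`()%classic (u^`(2)%classic z).
  by apply: is_derive_derive1; apply: (reg_derivable2 (bvp_reg hu)); rewrite in_itv in z01.
have := is_deriveB (is_deriveZ nu ddu) dfu; move/is_derive_eq; apply.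
rewrite -(bvp_eq hu) ?subrr//; by rewrite in_itv in z01.
Qed.

(** The first integral, compared at [y] and [c], gives [nu u'(y) = f(u y) - f(u c)]. Hence
    [w = u - u c] satisfies [|w'| <= (L / nu) |w|] and vanishes at [c], and Gronwall applies. *)
Lemma bvp_critical_cst (c : R) : c \in `]0, 1[%R -> u^`()%classic c = 0 ->
  forall x : R, x \in `[0, 1]%R -> u x = u c.
Proof.
move=> c01 uc0 x x01.
(* A first bound [M] on [u], possibly depending on [nu], provides a compact interval on which [f] is
   Lipschitz. *)
have [M M0 uM] := within_continuous_norm_bounded cu.
have [L L0 fL] := @C1_lipschitz_itv _ f (- M) M hf.
have uMM (y : R) : y \in `[0, 1]%R -> u y \in `[- M, M]%R.
  by move=> /uM; rewrite ler_norml in_itv.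
have oocc (y : R) : y \in `]0, 1[%R -> y \in `[0 : R, 1]%R by exact: subset_itv_oo_cc.
apply/eqP; rewrite -subr_eq0; apply/eqP.
have dw (y : R) : y \in `]0, 1[%R -> is_derive y 1 (fun y : R => u y - u c) (u^`()%classic y).
  move=> y01; have dcst : is_derive y 1 (fun=> u c) (0 : R) by exact: is_derive_cst.
  have := is_deriveB (is_derive_derive1 (du y01)) dcst.
  by move/is_derive_eq; apply; rewrite subr0.
apply: (@eq0_of_norm_derive_le _ (fun y : R => u y - u c) 0 1 c (L / nu)) => //.
- by move=> y; apply: cvgB; [exact: cu|exact: cvg_cst].
- by move=> y /dw[].
- move=> y y01; rewrite derive1E (@derive_val _ _ _ _ _ _ _ (dw y y01)).
  rewrite mulrAC ler_pdivlMr//.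
  have -> : `|u^`()%classic y| * nu = `|f (u y) - f (u c)|.
    rewrite -{1}(gtr0_norm nu0) -normrM; congr `|_|.
    by have := bvp_first_integral y01 c01; rewrite uc0; lra.
  by apply: fL; apply/uMM/oocc.
- exact: oocc.
- by rewrite subrr.
Qed.

(** A maximum principle: an extremum lies at an endpoint or is a critical point, and in the latter
    case [u] is constantly [u0]. The interval is free of [nu], which makes the final constant
    uniform. *)
Lemma bvp_range (x : R) : x \in `[0, 1]%R -> u x \in `[Num.min u0 u1, Num.max u0 u1]%R.
Proof.
have z01 : (0 : R) \in `[0, 1]%R by rewrite in_itv/= lexx ler01.
have endpoint (c : R) : c \in `[0, 1]%R -> (c \in `]0, 1[%R -> is_derive c 1 u 0) ->
    u c \in `[Num.min u0 u1, Num.max u0 u1]%R.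
  rewrite in_itv/= => /andP[]; rewrite le_eqVlt => /predU1P[<- _ _|c0].
    by rewrite (bvp_left hu) in_itv/= ge_min le_max lexx.
  rewrite le_eqVlt => /predU1P[-> _|c1 dc].
    by rewrite (bvp_right hu) in_itv/= ge_min le_max lexx !orbT.
  have c01 : c \in `]0, 1[%R by rewrite in_itv/= c0.
  have uc : u^`()%classic c = 0 by rewrite derive1E (@derive_val _ _ _ _ _ _ _ (dc c01)).
  rewrite -(bvp_critical_cst c01 uc z01) (bvp_left hu).
  by rewrite in_itv/= ge_min le_max lexx.
have [c c01 cmax] := EVT_max ler01 cu.
have [d d01 dmin] := EVT_min ler01 cu.
have oocc (y : R) : y \in `]0, 1[%R -> y \in `[0 : R, 1]%R by exact: subset_itv_oo_cc.
have /itvP hc := endpoint c c01 (fun h => derive1_at_max ler01 du h (fun t ht => cmax t (oocc t ht))).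
have /itvP hd := endpoint d d01 (fun h => derive1_at_min ler01 du h (fun t ht => dmin t (oocc t ht))).
move=> x01; rewrite in_itv/= (le_trans _ (dmin x x01)) ?hd//=.
by rewrite (le_trans (cmax x x01)) ?hc.
Qed.

Lemma bvp_dist_affine (K x : R) :
  (forall y, y \in `[Num.min u0 u1, Num.max u0 u1]%R -> `|f y| <= K) ->
  x \in `[0, 1]%R -> `|u x - ((u1 - u0) * x + u0)| <= 2 * K / nu.
Proof.
move=> fK x01.
have oocc (y : R) : y \in `]0, 1[%R -> y \in `[0 : R, 1]%R by exact: subset_itv_oo_cc.
pose w (y : R) := u y - ((u1 - u0) * y + u0).
have dw (y : R) : y \in `]0, 1[%R -> is_derive y 1 w (u^`()%classic y - (u1 - u0)).
  move=> y01; have da : is_derive y 1 (fun y : R => (u1 - u0) * y + u0) (u1 - u0).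
    by apply: is_derive_eq; rewrite /GRing.scale/=; ring.
  exact: is_deriveB (is_derive_derive1 (du y01)) da.
have cw : {within `[0, 1], continuous w}.
  move=> y; apply: cvgB; first exact: cu.
  apply: (continuous_subspaceT (f := fun y : R => (u1 - u0) * y + u0)) => z.
  by apply: cvgD; [apply: cvgMl_tmp; exact: cvg_id|exact: cvg_cst].
have w0 : w 0 = 0 by rewrite /w (bvp_left hu); ring.
have w1 : w 1 = 0 by rewrite /w (bvp_right hu); ring.
(* Rolle's theorem for [w]: at [z] the slope of [u] is exactly [u1 - u0]. *)
have [z z01] := MVT ltr01 dw cw; rewrite w0 w1 !subr0 mulr1 => dz0.
have fuK (y : R) : y \in `]0, 1[%R -> `|f (u y)| <= K by move=> /oocc/bvp_range/fK.
have K0 : 0 <= K by exact: le_trans (normr_ge0 _) (fuK z z01).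
have /[!in_itv]/= /andP[x0 x1] := x01.
(* The point [x = 0] is set apart because the mean value theorem on [[0, x]] needs [0 < x]. *)
rewrite -/(w x); move: x0; rewrite le_eqVlt => /predU1P[<-|x0].
  by rewrite w0 normr0 divr_ge0 ?mulr_ge0 ?(ltW nu0).
have sub (y : R) : y \in `]0, x[%R -> y \in `]0, 1[%R.
  by rewrite !in_itv/= => /andP[-> yx]; exact: lt_le_trans x1.
have cwx : {within `[0, x], continuous w}.
  by apply: continuous_subspaceW cw; apply: subset_itvl; rewrite bnd_simp.
have [y /sub y01] := MVT x0 (fun y hy => dw y (sub y hy)) cwx.
rewrite w0 !subr0 => ->; rewrite ler_pdivlMr// normrM (gtr0_norm x0).
(* Subtracting the first integral at [z] from that at [y] removes its unknown constant:
   [nu w'(y) = f(u y) - f(u z)], which is at most [2K] in absolute value. *)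
have -> : `|u^`()%classic y - (u1 - u0)| * x * nu = `|f (u y) - f (u z)| * x.
  rewrite mulrAC -{1}(gtr0_norm nu0) -normrM; congr (`|_| * _).
  have := bvp_first_integral y01 z01.
  have -> : u^`()%classic z = u1 - u0 by lra.
  lra.
rewrite -[leRHS]mulr1 ler_pM ?(ltW x0)//.
by rewrite (le_trans (ler_normB _ _))// mulr_natl mulr2n lerD// fuK.
Qed.

End bvp.

Theorem proposition4p12 (R : realType) (f : R -> R) (u0 u1 : R) (hf : C1 f) :
  exists C : R, 0 < C /\
    forall (nu : R) (u : R -> R), 1 <= nu -> bvp_solution f u0 u1 nu u ->
      forall x : R, 0 <= x <= 1 ->
        `|u x - ((u1 - u0) * x + u0)| <= C / nu.
Proof.
have [K K0 fK] := @within_continuous_norm_bounded _ f (Num.min u0 u1)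
  (Num.max u0 u1) (continuous_subspaceT (derivable_continuousT hf.1)).
(* [K] is fixed before [nu] and [u]; the added 1 keeps the constant positive when [K = 0]. *)
exists (2 * K + 1); split; first by lra.
move=> nu u nu1 hu x x01.
have nu0 : 0 < nu by exact: lt_le_trans nu1.
apply: le_trans (bvp_dist_affine hf nu0 hu fK _) _; first by rewrite in_itv.
by rewrite ler_pM2r ?invr_gt0// lerDl.
Qed.
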